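(* Let $X$ be a subshift (over a finite alphabet) that has property $(D)$ and that has a presentation with property $g$, i.e. $X$ is topologically conjugate to a subshift that has property $g$. Then $X$ admits a presentation by a contractive measure $\lambda$-graph system, i.e. $X$ is topologically conjugate to a subshift $\overline X\subset\overline\Sigma^{\mathbb Z}$ (with $\overline\Sigma$ a finite alphabet) that is presented by a contractive measure $\lambda$-graph system over $\overline\Sigma$.
   Context: Subshifts. A subshift $X\subset\Sigma^{\mathbb Z}$ over a finite alphabet $\Sigma$ is a closed shift-invariant set; a finite word is admissible if it appears in a point of $X$. Two subshifts are topologically conjugate if there is a shift-commuting homeomorphism between them. For an interval $I$ of integers, $X_I=\{(x_j)_{j\in I}:x\in X\}$. For a word $a\in X_{(-k,0]}$, $\Gamma_\infty^-(a)$ is the set of $y^-\in X_{(-\infty,-k]}$ with $(y^-,a)\in X_{(-\infty,0]}$, and $\omega_1^+(a)=\{\sigma\in\Sigma:(y^-,a,\sigma)\in X_{(-\infty,1]}\text{ for all }y^-\in\Gamma_\infty^-(a)\}$ (words are considered up to translation of indices). For a word $b$, $\Gamma^-(b)$ is the set of words $a$ such that $ab$ is admissible. For $x^-\in X_{(-\infty,0]}$, $\Delta_1^+(x^-)=\bigcup_{n\in\mathbb N}\omega_1^+(x^-_{[-n,0]})$. A subshift $X$ has property $g$ if $\Delta_1^+(x^-)\ne\emptyset$ for all $x^-\in X_{(-\infty,0]}$. It has property $(D)$ if for all admissible words $b\sigma$ of $X$ ($b$ a word, $\sigma\in\Sigma$) there exists a word $a\in\Gamma^-(b)$ such that $\sigma\in\omega_1^+(ab)$.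 Measure $\lambda$-graph systems. $\mathcal M(\Sigma)$ is the set of Borel probability measures on $\Sigma^{\mathbb N}$; $C(a)\subset\Sigma^{\mathbb N}$ is the cylinder of sequences beginning with the word $a$. For $\sigma\in\Sigma$ and $\mu\in\mathcal M(\Sigma)$ with $\mu(C(\sigma))>0$, $\tau_\sigma(\mu)\in\mathcal M(\Sigma)$ is given by $\tau_\sigma(\mu)(C(b))=\mu(C(\sigma b))/\mu(C(\sigma))$. Similarly, let $\mathcal M_N(\Sigma)$ be the set of probability vectors on $\Sigma^N$ ($N\ge1$) and $\mathcal M_0(\Sigma)=\{\emptyset\}$ (a single vertex). For $N\ge1$ and $\mu\in\mathcal M_N(\Sigma)$ giving positive mass to $\{a\in\Sigma^N:a_1=\sigma\}$, $\tau_\sigma(\mu)\in\mathcal M_{N-1}(\Sigma)$ is $\tau_\sigma(\mu)(b)=\mu(\sigma b)/\mu(\{a\in\Sigma^N:a_1=\sigma\})$ if $N>1$, and $\tau_\sigma(\mu)=\emptyset$ if $N=1$; there is then an edge labeled $\sigma$ from $\mu$ to $\tau_\sigma(\mu)$. For a word $a=a_1\dots a_n$ set $\tau_a=\tau_{a_n}\circ\cdots\circ\tau_{a_1}$ wherever defined. A set $\mathcal M\subset\mathcal M(\Sigma)$ is transition complete if $\mu\in\mathcal M$, $\sigma\in\Sigma$, $\mu(C(\sigma))>0$ imply $\tau_\sigma(\mu)\in\mathcal M$; it is in-complete if for every $\mu\in\mathcal M$ there are $\nu\in\mathcal M$ and $\sigma\in\Sigma$ with $\nu(C(\sigma))>0$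 and $\tau_\sigma(\nu)=\mu$. The measure $\lambda$-graph system of a transition complete and in-complete $\mathcal M$ is the labeled directed graph with vertex set $\bigcup_{N\in\mathbb Z_+}\mathcal M_N$, where for $N\ge 1$ $\mathcal M_N\subset\mathcal M_N(\Sigma)$ is the set of marginals on the first $N$ coordinates of the measures in $\mathcal M$, and $\mathcal M_0=\{\emptyset\}$, with edges given by the $\tau_\sigma$. It presents $X$ if the set of admissible words of $X$ coincides with the set of label sequences of finite paths in it. A measure $\lambda$-graph system $\bigcup_N\mathcal M_N$ presenting $X$ is contractive if for all $x^-\in X_{(-\infty,0]}$ $$\lim_{n\to\infty}\operatorname{diam}\{\tau_{x^-_{(-n,0]}}(\mu):\mu\in\mathcal M_{n+1},\ \tau_{x^-_{(-n,0]}}(\mu)\text{ is defined}\}=0,$$ the diameter being taken in $\mathcal M_1(\Sigma)\subset\mathbb R^\Sigma$. *)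

(* Defs.v *)
From HB Require Import structures.
From mathcomp Require Import all_boot all_order all_algebra.
From mathcomp Require Import all_classical all_reals all_analysis.

Set Implicit Arguments.
Unset Strict Implicit.
Unset Printing Implicit Defensive.

Import Order.TTheory GRing.Theory Num.Theory.
Import numFieldNormedType.Exports.
Local Open Scope classical_set_scope.
Local Open Scope ring_scope.

(* Measurable types are pointed in the library, so the alphabets that carry
   measures are nonempty finite types. *)
#[short(type="pfinType")]
HB.structure Definition PFinite := {T of Finite T & Pointed T}.

Notation fullshift S := {ptws int -> discrete_topology S}.

Section Subshifts.
Variable S : finType.
Implicit Types (X : set (fullshift S)) (x : fullshift S) (y : nat -> S).
Implicit Types (a b w : seq S) (s : S).

Definition shift x : fullshift S := fun i => x (i + 1).

Definition subshift X : Prop := closed X /\ shift @` X = X.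

Definition admissible X w : Prop :=
  exists2 x, X x & exists i : int, mkseq (fun j => x (i + j%:Z)) (size w) = w.

(* A left-infinite sequence is stored as y : nat -> S, with y j the symbol at
   index - j. By shift-invariance, left_rays X is X_(-oo, k] up to a
   translation of indices, for every k. *)
Definition left_rays X : set (nat -> S) :=
  [set y | exists2 x, X x & forall j : nat, y j = x (- j%:Z)].

(* The left-infinite sequence (y, w): its last size w symbols spell w. *)
Definition ray_cat y w : nat -> S := fun j => nth (y (j - size w)%N) (rev w) j.

(* The last n symbols of y in reading order, that is y_(-n, 0]. *)
Definition ray_word y n : seq S := rev (mkseq y n).

Definition Gamma_inf X a : set (nat -> S) :=
  [set y | left_rays X y /\ left_rays X (ray_cat y a)].

Definition omega1 X a : set S :=
  [set s | forall y, Gamma_inf X a y -> left_rays X (ray_cat y (rcons a s))].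

Definition Gamma X b : set (seq S) := [set a | admissible X (a ++ b)].

(* y_[-n, 0] has n + 1 symbols. *)
Definition Delta1 X y : set S := \bigcup_n omega1 X (ray_word y n.+1).

Definition property_g X : Prop :=
  forall y, left_rays X y -> Delta1 X y !=set0.

Definition property_D X : Prop :=
  forall b s, admissible X (rcons b s) ->
    exists2 a, Gamma X b a & omega1 X (a ++ b) s.

End Subshifts.

(* Here X and Y also denote the subtypes they span, with the induced topology;
   the last clause says that f commutes with the shifts. *)
Definition conjugate (S T : finType) (X : set (fullshift S))
    (Y : set (fullshift T)) : Prop :=
  exists (f : X -> Y) (g : Y -> X),
    [/\ continuous f, continuous g, cancel f g, cancel g f &
        forall x x' : X, \val x' = shift (\val x) ->
          \val (f x') = shift (\val (f x))].

Notation onesided S := {ptws nat -> discrete_topology S}.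
Notation borel_onesided S := (g_sigma_algebraType (@open (onesided S))).

Section MeasureGraphs.
Variables (R : realType) (S : pfinType).
Implicit Types (mu nu : probability (borel_onesided S) R).
Implicit Types (M : set (probability (borel_onesided S) R)) (w : seq S) (s : S).

Definition cylinder w : set (borel_onesided S) :=
  [set x | mkseq x (size w) = w].

Definition mass mu w : R := fine (mu (cylinder w)).

(* nu = tau_s(mu), assuming 0 < mass mu [:: s]. A library measure also takes
   (meaningless) values on non-measurable sets, so tau_s(mu) is not unique for
   Leibniz equality; equality of Borel measures is agreement on cylinders. *)
Definition is_tau s mu nu : Prop :=
  forall b, mass nu b = mass mu (s :: b) / mass mu [:: s].

Definition transition_complete M : Prop :=
  forall mu s, M mu -> 0 < mass mu [:: s] -> exists2 nu, M nu & is_tau s mu nu.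

Definition in_complete M : Prop :=
  forall mu, M mu -> exists nu s, [/\ M nu, 0 < mass nu [:: s] & is_tau s nu mu].

(* Vectors on S^N; the single vertex of level 0 is the probability vector on
   the one word of length 0. *)
Notation vec N := {ffun N.-tuple S -> R}.

Definition first_mass N (p : vec N.+1) s : R := \sum_(a | thead a == s) p a.

Definition ftau N s (p : vec N.+1) : option (vec N) :=
  if 0 < first_mass p s
  then Some [ffun b : N.-tuple S => p [tuple of s :: b] / first_mass p s]
  else None.

(* Typed so that size (s :: w) + N is convertible to (size w + N).+1. *)
Fixpoint ftau_word N w : vec (size w + N) -> option (vec N) :=
  match w with
  | [::] => fun p => Some p
  | s :: w' => fun p => obind (@ftau_word N w') (ftau s p)
  end.

Definition marginal N mu : vec N := [ffun a : N.-tuple S => mass mu a].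

Definition level M N : set (vec N) :=
  match N with
  | 0 => [set [ffun=> 1]]
  | N'.+1 => [set marginal N'.+1 mu | mu in M]
  end.

Definition vertex : Type := {N : nat & vec N}.

Definition is_vertex M (v : vertex) : Prop := level M (projT2 v).

Inductive edge M : vertex -> S -> vertex -> Prop :=
  Edge N s (p : vec N.+1) (q : vec N) of
    level M p & level M q & ftau s p = Some q :
      edge M (existT _ N.+1 p) s (existT _ N q).

Fixpoint labels_path_from M (v : vertex) w : Prop :=
  match w with
  | [::] => is_vertex M v
  | s :: w' => exists2 v', edge M v s v' & labels_path_from M v' w'
  end.

(* Nonempty words only: the empty word labels the trivial path at level 0 but
   occurs in no point of the empty subshift. *)
Definition presents M (X : set (fullshift S)) : Prop :=
  forall w, w != [::] ->
    (admissible X w <-> exists v, labels_path_from M v w).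

(* The Euclidean distance of R^S, a 1-tuple being identified with its entry. *)
Definition dist1 (p q : vec 1) : R := Num.sqrt (\sum_a (p a - q a) ^+ 2).

Definition diam (A : set (vec 1)) : \bar R :=
  ereal_sup [set (dist1 p q)%:E | p in A & q in A].

(* With w = y_(-n, 0], level M (size w + 1) is the level n + 1. *)
Definition tau_images M w : set (vec 1) :=
  [set q | exists2 p : vec (size w + 1), level M p & ftau_word p = Some q].

Definition contractive M (X : set (fullshift S)) : Prop :=
  forall y, left_rays X y ->
    diam (tau_images M (ray_word y n)) @[n --> \oo] --> 0%E.

End MeasureGraphs.

(* Main.v *)
Require Import Defs.
From HB Require Import structures.
From mathcomp Require Import all_boot all_order all_algebra.
From mathcomp Require Import all_classical all_reals all_analysis.
From mathcomp Require Import zify ring lra.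

(** Property (D) is invariant under conjugacy, so a conjugate Y of X with property
    g has both properties.  Let a symbol s follow a past y when s lies in the
    omega set of some finite suffix of y, and give it the weight 1 / (k + 1) for
    the shortest such suffix, of length k.  Weights of pasts that agree on their
    last n symbols differ by at most 1 / (n + 1); property g makes the total
    weight of a past positive, so the normalized weights are transition
    probabilities continuous in the past.  The Markov measures started at the
    pasts all of whose symbols follow their own past form a transition complete
    and in-complete set; continuity makes it contractive, and (D), applied
    repeatedly to the left, puts every admissible word at the end of such a
    past. *)

Set Implicit Arguments.
Unset Strict Implicit.
Unset Printing Implicit Defensive.

Import Order.TTheory GRing.Theory Num.Theory.
Import numFieldNormedType.Exports.
Local Open Scope classical_set_scope.
Local Open Scope ring_scope.

(** * Product topology and compactness of sequence spaces over a finite alphabet *)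

Section ProductOfDiscrete.
Variables (I : eqType) (S : finType).
Implicit Types (x y : {ptws I -> discrete_topology S}) (F : seq I).

Definition agree F x : set {ptws I -> discrete_topology S} :=
  [set y : {ptws I -> discrete_topology S} | forall i, i \in F -> y i = x i].

Lemma nbhs_agree x F : nbhs x (agree F x).
Proof.
elim: F => [|i F IH]; first by apply: filterS filterT => y _ i.
have nxi : nbhs x (fun y => y i = x i).
  have := @proj_continuous I (fun=> discrete_topology S) i x [set x i].
  by apply; apply: discrete_set1.
by apply: filterS2 nxi IH => y yi yF j; rewrite inE => /orP[/eqP->|/yF].
Qed.

(** The product topology is a supremum of initial topologies, so it suffices that the filter
    generated by the sets [agree F x] converges in each coordinate, where a singleton [F] fixes the
    symbol. *)
Lemma nbhs_agreeP x (A : set {ptws I -> discrete_topology S}) :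
  nbhs x A <-> exists F, agree F x `<=` A.
Proof.
split=> [|[F /filterS]]; last by apply; exact: nbhs_agree.
pose G := filter_from [set: seq I] (agree^~ x).
have FG : Filter G.
  apply: filter_from_filter; first by exists [::].
  move=> F1 F2 _ _; exists (F1 ++ F2) => // y yF; split=> i iF;
    by apply: yF; rewrite mem_cat iF ?orbT.
suff Gx : G --> x by move=> /Gx[F _]; exists F.
apply/cvg_sup => i; apply/cvg_image.
  by rewrite eqEsubset; split=> // s _; exists (fun=> s).
move=> B; rewrite nbhs_principalE => /principal_filterP Bx.
exists ((@^~ i) @^-1` B).
  by exists [:: i] => // y /(_ i) /=; rewrite mem_head => ->.
rewrite eqEsubset; split=> [s [y By <-]|s Bs]; first exact: By.
by exists (fun=> s).
Qed.

Lemma ptws_finite_compact : compact [set: {ptws I -> discrete_topology S}].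
Proof.
have := @tychonoff I (fun=> discrete_topology S) (fun=> setT).
rewrite (_ : [set f | _] = setT); last by rewrite eqEsubset; split.
by apply=> i; apply: finite_compact; apply: finite_finset.
Qed.

(** Compactness yields a cluster point of [u] in the closed set. Instead of extracting a
    subsequence, the statement records that each finite window of the cluster point recurs
    arbitrarily late. *)
Lemma cluster_seq (X : set {ptws I -> discrete_topology S})
    (u : nat -> {ptws I -> discrete_topology S}) :
  closed X -> (forall n, X (u n)) ->
  exists2 x, X x &
    forall F N, exists2 n, (N <= n)%N & forall i, i \in F -> u n i = x i.
Proof.
move=> clX Xu.
have cX : compact X by apply: subclosed_compact ptws_finite_compact _.
have uX : (u @ \oo) X by exists 0%N => // n _; exact: Xu.
have [x [Xx /= ux]] := cX (u @ \oo) _ uX.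
exists x => // F N.
have [y [[n /= Nn <-] yF]] : (u @` [set n | (N <= n)%N]) `&` agree F x !=set0.
  apply: ux; last exact: nbhs_agree.
  by exists N => // n Nn; exists n.
by exists n.
Qed.

End ProductOfDiscrete.

(** * Finite windows of continuous maps between subshifts *)

Section SlidingBlockCodes.
Variables (S T : finType) (X : set (fullshift S)) (Y : set (fullshift T)).

Definition iagree (U : Type) (lo hi : int) (x y : int -> U) : Prop :=
  forall i, lo <= i < hi -> x i = y i.

(** Forward translations iterate the shift; backward ones come from its surjectivity on [X], which
    supplies a preimage at each step. *)
Lemma sub_shift : subshift X -> forall (x : fullshift S) k, X x ->
  X ((fun i => x (i + k)) : fullshift S).
Proof.
move=> [_ XX].
have Xp n x : X x -> X ((fun i => x (i + n%:Z)) : fullshift S).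
  elim: n => [|n IH] Xx; first by under eq_fun do rewrite addr0.
  have : X (Defs.shift ((fun i => x (i + n%:Z)) : fullshift S)).
    by rewrite -XX; exists (fun i => x (i + n%:Z)) => //; exact: IH.
  congr X; apply: funext => i; rewrite /Defs.shift -addrA; congr (x (i + _)); lia.
have Xm n x : X x -> X ((fun i => x (i - n%:Z)) : fullshift S).
  elim: n => [|n IH] Xx; first by under eq_fun do rewrite subr0.
  have := IH Xx; rewrite -{1}XX => -[x' Xx' e].
  suff -> : (fun i => x (i - n.+1%:Z)) = x' by [].
  apply: funext => i.
  have := congr1 (fun f : fullshift S => f (i - 1)) e.
  rewrite /Defs.shift subrK => ->.
  by congr x; lia.
move=> x [n|n] Xx; first exact: Xp.
by have := Xm n.+1 x Xx; congr X; apply: funext => i; congr x; lia.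
Qed.

(** Otherwise, for every [L], some pair agrees on [[-L, L]] but has different images at 0. At a
    cluster point of the first members, continuity makes coordinate 0 of the image depend on a
    finite set [F] of coordinates only. *)
Lemma continuous_coord (f : X -> Y) : closed X -> continuous f ->
  exists L : nat, forall x x' : X,
    iagree (- L%:Z) (L%:Z + 1) (\val x) (\val x') ->
    \val (f x) 0 = \val (f x') 0.
Proof.
move=> clX cf; apply: contrapT => /forallNP noL.
have {}noL L : exists xx : X * X,
    iagree (- L%:Z) (L%:Z + 1) (\val xx.1) (\val xx.2) /\
    \val (f xx.1) 0 <> \val (f xx.2) 0.
  have /existsNP[x /existsNP[x' /not_implyP[]]] := noL L.
  by exists (x, x').
have [u uP] := choice noL.
have Xu n : X (\val (u n).1) by exact: set_valP.
have [x Xx ux] := cluster_seq clX Xu.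
pose z : X := SigSub (mem_set Xx).
have : nbhs z (f @^-1` (\val @^-1` (agree [:: 0 : int] (\val (f z))))).
  apply: cf; apply: (@initial_continuous Y (fullshift T) set_val (f z)).
  exact: nbhs_agree.
case=> /= B [[C oC <-] Cz] BA.
have /nbhs_agreeP[F FC] : nbhs x C.
  by apply: open_nbhs_nbhs; split.
(* The window of radius [N] contains [F], so for [n >= N] the second member of the pair [u n] agrees
   with [x] on [F] as soon as the first one does. *)
pose N := \max_(i <- F) `|i|%N.
have FN i : i \in F -> - N%:Z <= i < N%:Z + 1.
  move=> iF; suff : (`|i| <= N)%N by lia.
  by rewrite /N; apply: leq_bigmax_seq.
have [n Nn un] := ux F N.
have [u12 []] := uP n.
have E v : agree F x (\val v) -> \val (f v) 0 = \val (f z) 0.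
  by move=> /FC Cv; apply: (BA v Cv); rewrite mem_head.
have u1 : agree F x (\val (u n).1) by exact: un.
have u2 : agree F x (\val (u n).2).
  by move=> i iF; rewrite -u1 // u12 //; have := FN _ iF; lia.
by rewrite (E _ u1) (E _ u2).
Qed.

End SlidingBlockCodes.

(** * Calculus of finite words and left rays *)

Section Words.
Variable S : finType.
Implicit Types (x : fullshift S) (y : nat -> S) (w a b c u v : seq S) (s t : S).
Implicit Types (i k : int).

Definition word_at x i n : seq S := mkseq (fun j => x (i + j%:Z)) n.

Definition ray x k : nat -> S := fun j => x (k - j%:Z).

(** Rays are indexed backwards from their last symbol, so appending on the right inserts at index
    0. *)
Definition snoc y s : nat -> S := fun j => if j is j'.+1 then y j' else s.

Lemma size_word_at x i n : size (word_at x i n) = n.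
Proof. exact: size_mkseq. Qed.

Lemma word_atS x i n : word_at x i n.+1 = rcons (word_at x i n) (x (i + n%:Z)).
Proof. exact: mkseqS. Qed.

Lemma word_at_cat x i m n :
  word_at x i (m + n) = word_at x i m ++ word_at x (i + m%:Z) n.
Proof.
elim: n => [|n IH]; first by rewrite addn0 cats0.
by rewrite addnS !word_atS IH -rcons_cat; congr (rcons _ (x _)); lia.
Qed.

Lemma eq_word_at x x' i n :
  iagree i (i + n%:Z) x x' -> word_at x i n = word_at x' i n.
Proof.
move=> xx'; apply/eq_in_map => j; rewrite mem_iota => /andP[_ jn].
by apply: xx'; lia.
Qed.

Lemma word_at_inj x x' i n :
  word_at x i n = word_at x' i n -> iagree i (i + n%:Z) x x'.
Proof.
move=> e j ij; have jn : (`|j - i| < n)%N by lia.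
have := congr1 (fun w => nth (x j) w `|j - i|%N) e.
rewrite !nth_mkseq //.
by rewrite (_ : i + _ = j) //; lia.
Qed.

Lemma word_at_shift x k i n :
  word_at ((fun j => x (j + k)) : fullshift S) i n = word_at x (i + k) n.
Proof. by apply: eq_map => j; congr x; lia. Qed.

Lemma word_at_catP x i u v :
  word_at x i (size (u ++ v)) = u ++ v <->
  word_at x i (size u) = u /\ word_at x (i + (size u)%:Z) (size v) = v.
Proof.
rewrite size_cat word_at_cat; split=> [/eqP|[-> ->] //].
by rewrite eqseq_cat ?size_word_at // => /andP[/eqP-> /eqP->].
Qed.

Lemma raySl x k : ray x (k + 1) = snoc (ray x k) (x (k + 1)).
Proof. by apply: funext => -[|j]; rewrite /ray /= ?subr0 //; congr x; lia. Qed.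

Lemma ray_cat0 y : ray_cat y [::] = y.
Proof. by apply: funext => j; rewrite /ray_cat nth_nil subn0. Qed.

Lemma ray_cat_rcons y w s : ray_cat y (rcons w s) = snoc (ray_cat y w) s.
Proof.
by apply: funext => -[|j]; rewrite /ray_cat rev_rcons size_rcons //= subSS.
Qed.

Lemma ray_cat_cat y u v : ray_cat y (u ++ v) = ray_cat (ray_cat y u) v.
Proof.
elim/last_ind: v => [|v s IH]; first by rewrite cats0 ray_cat0.
by rewrite -rcons_cat !ray_cat_rcons IH.
Qed.

Lemma ray_cat1 y s : ray_cat y [:: s] = snoc y s.
Proof. by rewrite (ray_cat_rcons y [::]) ray_cat0. Qed.

Lemma ray_cat_cons y s w : ray_cat y (s :: w) = ray_cat (snoc y s) w.
Proof. by rewrite -cat1s ray_cat_cat ray_cat1. Qed.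

Lemma ray_word0 y : ray_word y 0 = [::]. Proof. by []. Qed.

Lemma ray_wordS y n :
  ray_word y n.+1 = rcons (ray_word (fun j => y j.+1) n) (y 0%N).
Proof.
rewrite /ray_word /mkseq /= rev_cons; congr (rcons (rev _) _).
by rewrite (iotaDl 1 0) -map_comp.
Qed.

Lemma size_ray_word y n : size (ray_word y n) = n.
Proof. by rewrite size_rev size_mkseq. Qed.

Lemma ray_cat_ray_word y n : ray_cat (fun j => y (j + n)%N) (ray_word y n) = y.
Proof.
elim: n y => [|n IH] y.
  by rewrite ray_cat0; under eq_fun do rewrite addn0.
rewrite ray_wordS ray_cat_rcons; have := IH (fun j => y j.+1).
under eq_fun do rewrite -addnS.
by move->; apply: funext => -[].
Qed.

Lemma ray_word_cat y w n :
  ray_word (ray_cat y w) (size w + n) = ray_word y n ++ w.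
Proof.
elim/last_ind: w => [|w s IH]; first by rewrite ray_cat0 cats0.
by rewrite size_rcons ray_cat_rcons addSn ray_wordS /= IH rcons_cat.
Qed.

Lemma ray_wordD y m n :
  ray_word y (m + n) = ray_word (fun j => y (j + m)%N) n ++ ray_word y m.
Proof.
have := ray_word_cat (fun j => y (j + m)%N) (ray_word y m) n.
by rewrite ray_cat_ray_word size_ray_word.
Qed.

Lemma eq_ray_word y y' n : (forall j, (j < n)%N -> y j = y' j) ->
  ray_word y n = ray_word y' n.
Proof.
move=> yy'; congr rev; apply/eq_in_map => j; rewrite mem_iota => /andP[_ jn].
exact: yy'.
Qed.

Lemma ray_cat_word_at x k n :
  ray_cat (ray x k) (word_at x (k + 1) n) = ray x (k + n%:Z).
Proof.
elim: n => [|n IH]; first by rewrite ray_cat0 addr0.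
rewrite word_atS ray_cat_rcons IH.
rewrite (_ : k + n.+1%:Z = k + n%:Z + 1); last by lia.
by rewrite raySl; congr (snoc _ (x _)); lia.
Qed.

Lemma ray_word_ray x k n : ray_word (ray x k) n = word_at x (k + 1 - n%:Z) n.
Proof.
elim: n k => [//|n IH] k; rewrite ray_wordS word_atS.
congr rcons; last by rewrite /ray; congr x; lia.
rewrite (_ : (fun j => _) = ray x (k - 1)); last first.
  by apply: funext => j; rewrite /ray; congr x; lia.
by rewrite IH; congr word_at; lia.
Qed.

End Words.

(** * The sets [omega1] and the words forced by a past *)

Section Subshift.
Variables (S : finType) (X : set (fullshift S)).
Hypothesis subX : subshift X.
Implicit Types (x : fullshift S) (y : nat -> S) (w a b c u v : seq S) (s t : S).
Implicit Types (i k : int).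

Lemma left_raysP k y : left_rays X y <-> exists2 x, X x & y = ray x k.
Proof.
split=> [[x Xx yx]|[x Xx ->]].
  exists (fun j => x (j - k)); first exact: (sub_shift subX).
  by apply: funext => j; rewrite yx /ray; congr x; lia.
exists (fun j => x (j + k)); first exact: (sub_shift subX).
by move=> j; rewrite /ray; congr x; lia.
Qed.

Lemma admissibleP i w :
  admissible X w <-> exists2 x, X x & word_at x i (size w) = w.
Proof.
split=> [[x Xx [k xw]]|[x Xx xw]]; last by exists x => //; exists i.
exists (fun j => x (j + (k - i))); first exact: (sub_shift subX).
by rewrite word_at_shift addrC subrK.
Qed.

Lemma admissible_catr u v : admissible X (u ++ v) -> admissible X v.
Proof.
move=> /(admissibleP 0)[x Xx /word_at_catP[_ xv]].
by apply/(admissibleP (0 + (size u)%:Z)); exists x.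
Qed.

Lemma admissible_catl u v : admissible X (u ++ v) -> admissible X u.
Proof.
move=> /(admissibleP 0)[x Xx /word_at_catP[xu _]].
by apply/(admissibleP 0); exists x.
Qed.

(** Left rays are restrictions of points, so the definition can be read as surgery on points: the
    part of [x] to the right of [a] may be replaced so as to begin with [s], while the past is
    kept. *)
Lemma omega1P i a s : omega1 X a s <->
  forall x, X x -> word_at x i (size a) = a ->
    exists x', [/\ X x', forall j, j < i + (size a)%:Z -> x' j = x j
                 & x' (i + (size a)%:Z) = s].
Proof.
split=> [oas x Xx xa|oas y [/(left_raysP (i - 1))[x0 Xx0 ->]]].
  have e : ray_cat (ray x (i - 1)) a = ray x (i - 1 + (size a)%:Z).
    by rewrite -{1}xa -ray_cat_word_at subrK.
  have /oas : Gamma_inf X a (ray x (i - 1)).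
    by split; [|rewrite e]; apply/left_raysP; exists x.
  move=> /(left_raysP (i + (size a)%:Z))[x' Xx']; rewrite ray_cat_rcons e => e'.
  exists x'; split=> [//|j jlt|].
    have := congr1 (fun f : nat -> S => f `|(i + (size a)%:Z - j)%R|%N) e'.
    case E : (`| _ |%N) => [|n] /=; first by move: E jlt; lia.
    by rewrite /ray => xx; transitivity (x' (i + (size a)%:Z - n.+1%:Z));
      [congr x'|rewrite -xx; congr x]; lia.
  by have := congr1 (fun f : nat -> S => f 0%N) e'; rewrite /ray /= subr0.
move=> /(left_raysP (i - 1 + (size a)%:Z))[x Xx e].
have xa : word_at x i (size a) = a.
  have := ray_word_cat (ray x0 (i - 1)) a 0; rewrite addn0 e /= => {2}<-.
  by rewrite ray_word_ray; congr word_at; lia.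
have [x' [Xx' x'x <-]] := oas x Xx xa.
apply/(left_raysP (i + (size a)%:Z)); exists x' => //.
rewrite ray_cat_rcons e; apply: funext => -[|j]; rewrite /ray /= ?subr0 //.
by rewrite x'x; [congr x|]; lia.
Qed.

Lemma omega1_cat u a s : omega1 X a s -> omega1 X (u ++ a) s.
Proof.
move=> /(omega1P (0 + (size u)%:Z)) oas.
apply/(omega1P 0) => x Xx /word_at_catP[_ xa].
by rewrite size_cat PoszD addrA; exact: oas xa.
Qed.

Lemma omega1_admissible a s :
  admissible X a -> omega1 X a s -> admissible X (rcons a s).
Proof.
move=> /(admissibleP 0)[x Xx xa] /(omega1P 0)/(_ x Xx xa)[x' [Xx' x'x x's]].
apply/(admissibleP 0); exists x' => //.
rewrite size_rcons word_atS x's; congr rcons; rewrite -[RHS]xa.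
by apply: eq_word_at => j ja; apply: x'x; lia.
Qed.

(* Every left ray of X ending with v stays one when u is appended letter by
   letter, each step being forced by finitely many past symbols. *)
Fixpoint forced v u : Prop :=
  if u is s :: u' then omega1 X v s /\ forced (rcons v s) u' else True.

Lemma forced_rcons v u s :
  forced v (rcons u s) <-> forced v u /\ omega1 X (v ++ u) s.
Proof.
elim: u v => [|t u IH] v /=; first by rewrite cats0; tauto.
by rewrite IH cat_rcons; tauto.
Qed.

Lemma forced_cat w v u : forced v u -> forced (w ++ v) u.
Proof.
elim: u v => [//|s u IH] v /= [ovs /IH fu].
by rewrite rcons_cat; split=> //; exact: omega1_cat.
Qed.

(** Iterates the surgery of [omega1P] letter by letter; each replacement leaves the letters already
    written untouched. *)
Lemma forcedP i v u x : forced v u -> X x -> word_at x i (size v) = v ->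
  exists x', [/\ X x', forall j, j < i + (size v)%:Z -> x' j = x j
               & word_at x' (i + (size v)%:Z) (size u) = u].
Proof.
elim: u v x => [|s u IH] v x /=; first by exists x.
move=> [/(omega1P i) ovs fu] Xx xv.
have [x1 [Xx1 x1x x1s]] := ovs x Xx xv.
have x1v : word_at x1 i (size (rcons v s)) = rcons v s.
  rewrite size_rcons word_atS x1s; congr rcons; rewrite -[RHS]xv.
  by apply: eq_word_at => j ja; apply: x1x; lia.
have [x2 [Xx2 x2x x2u]] := IH _ _ fu Xx1 x1v.
rewrite size_rcons in x2x x2u.
exists x2; split=> // [j jlt|]; first by rewrite x2x ?x1x //; lia.
apply/(word_at_catP x2 _ [:: s] u) => /=; split.
  rewrite /word_at /mkseq /= addr0 x2x ?x1s //; lia.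
by rewrite -[RHS]x2u; congr word_at; lia.
Qed.

(** Induction on [c] from its right end. Property (D) gives [a0] such that the last letter is forced
    after [a0 ++ b ++ c]; the induction hypothesis for [a0 ++ b] prepends [a1] to force the other
    letters, and by [omega1_cat] the longer past still forces the last one. *)
Lemma property_D_forced : property_D X -> forall c b, admissible X (b ++ c) ->
  exists a, admissible X (a ++ b ++ c) /\ forced (a ++ b) c.
Proof.
move=> DX; elim/last_ind => [|c s IH] b; first by exists [::].
rewrite -rcons_cat => bcs; have [a0 a0bc oa0] := DX _ _ bcs.
have [|a1 [a1bc fa1]] := IH (a0 ++ b); first by rewrite -catA.
exists (a1 ++ a0).
have o : omega1 X ((a1 ++ a0) ++ b ++ c) s.
  by rewrite -catA; exact: omega1_cat.
split; last by rewrite forced_rcons -!catA in fa1 o *.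
by rewrite -rcons_cat; apply: omega1_admissible => //; rewrite -!catA in a1bc *.
Qed.

End Subshift.

(** * Sliding block codes and the conjugacy invariance of property (D) *)

Section BlockCodes.
Variables (S T : finType) (X : set (fullshift S)) (Y : set (fullshift T)).

Definition block_radius (f : X -> Y) (L : nat) : Prop :=
  forall (x x' : X) (lo hi : int),
    iagree (lo - L%:Z) (hi + L%:Z) (\val x) (\val x') ->
    iagree lo hi (\val (f x)) (\val (f x')).

Lemma block_radiusS f L L' : (L <= L')%N -> block_radius f L -> block_radius f L'.
Proof. by move=> LL' fL x x' lo hi xx'; apply: fL => i ilh; apply: xx'; lia. Qed.

(** The Curtis-Hedlund-Lyndon theorem: [continuous_coord] treats coordinate 0, and commuting with
    translations carries its window to every coordinate. *)
Lemma sliding_block_code (f : X -> Y) : subshift X -> continuous f ->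
  (forall x x' : X, \val x' = Defs.shift (\val x) ->
     \val (f x') = Defs.shift (\val (f x))) ->
  exists L, block_radius f L.
Proof.
move=> subX cf sf; have [L fL] := continuous_coord (proj1 subX) cf.
pose tr (x : X) (k : int) : X := SigSub (mem_set (sub_shift subX k (set_valP x))).
have ftr_nat (x : X) (n : nat) :
    \val (f (tr x n%:Z)) = (fun i => \val (f x) (i + n%:Z)).
  elim: n => [|n IH].
    rewrite (_ : tr x 0 = x); first by apply: funext => i; rewrite addr0.
    by apply: val_inj; apply: funext => i /=; rewrite addr0.
  rewrite (sf (tr x n%:Z)) ?IH.
    by apply: funext => i; rewrite /Defs.shift; congr (\val (f x) _); lia.
  by apply: funext => i; rewrite /Defs.shift /=; congr (\val x _); lia.
have ftr (x : X) k i : \val (f (tr x k)) i = \val (f x) (i + k).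
  case: k => n; first by rewrite ftr_nat.
  (* A backward translate is handled by writing [x] as a forward translate of it. *)
  rewrite [in RHS](_ : x = tr (tr x (Negz n)) n.+1%:Z); last first.
    by apply: val_inj => /=; apply: funext => j; congr (\val x _); lia.
  by rewrite ftr_nat; congr (\val (f _) _); lia.
exists L => x x' lo hi xx' i ilh.
have := fL (tr x i) (tr x' i); rewrite !ftr add0r; apply => j jL /=.
by apply: xx'; lia.
Qed.

End BlockCodes.

(* For a word b s of a point y of Y, property (D) of X at the X-word of g y around
   it gives a past a that forces the part of g y read off from s and its right
   context; the image of a under f is then a past forcing s after b. *)
Lemma conjugate_property_D (S T : finType) (X : set (fullshift S))
    (Y : set (fullshift T)) :
  subshift X -> subshift Y -> conjugate X Y ->
  property_D X -> property_D Y.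
Proof.
move=> subX subY [f [g [cf cg fK gK sf]]] DX.
have sg (y y' : Y) :
    \val y' = Defs.shift (\val y) -> \val (g y') = Defs.shift (\val (g y)).
  move=> yy'; have Xs : X (Defs.shift (\val (g y))).
    by case: subX => _ {1}<-; exists (\val (g y)) => //; exact: set_valP.
  pose x' : X := SigSub (mem_set Xs).
  suff -> : y' = f x' by rewrite fK.
  by apply: val_inj; rewrite yy' (sf (g y) x') // gK.
have [L1 fL1] := sliding_block_code subX cf sf.
have [L2 gL2] := sliding_block_code subY cg sg.
pose L := maxn L1 L2.
have fL := block_radiusS (leq_maxl L1 L2) fL1; rewrite -/L in fL.
have gL := block_radiusS (leq_maxr L1 L2) gL2; rewrite -/L in gL.
move=> b s /(admissibleP subY 0)[y0 Yy0 /eqP].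
rewrite size_rcons word_atS eqseq_rcons add0r => /andP[/eqP yb /eqP ys].
pose y : Y := SigSub (mem_set Yy0).
pose p : int := (size b)%:Z.
pose x : X := g y.
(* With [b] at [[0, p[], the word [b'] covers [[-3L, p - L[] and [c] covers [[p - L, p + L]]. The
   cut is at [p - L] because knowing a point of [Y] left of [p] determines its image under [g] only
   left of [p - L]. The margin [3L] contains the [L]-windows of all coordinates in [[p - 2L, p]],
   even for empty [b]. *)
pose q0 : int := - (3 * L)%:Z.
pose nb := (size b + 2 * L)%N.
pose nc := (2 * L).+1.
pose b' := word_at (\val x) q0 nb.
pose c := word_at (\val x) (q0 + nb%:Z) nc.
have b'c : b' ++ c = word_at (\val x) q0 (nb + nc) by rewrite word_at_cat.
have [|a [ab'c fc]] := property_D_forced subX DX (b := b') (c := c).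
  apply/(admissibleP subX q0); exists (\val x); first exact: set_valP.
  by rewrite size_cat !size_word_at b'c.
pose r0 : int := q0 - (size a)%:Z.
have [x1' Xx1 /word_at_catP[x1a x1b'c]] := proj1 (admissibleP subX r0 _) ab'c.
pose x1 : X := SigSub (mem_set Xx1).
have x1x : iagree q0 (q0 + (nb + nc)%:Z) x1' (\val x).
  apply: word_at_inj; rewrite -b'c -[RHS]x1b'c size_cat !size_word_at.
  by congr word_at; lia.
pose y1 := f x1.
have y1y : iagree (q0 + L%:Z) (p + 1) (\val y1) y0.
  have /= -> : y0 = \val (f x) by rewrite gK.
  by apply: fL => i ilh; apply: x1x; move: ilh; rewrite /q0 /p /nb /nc; lia.
(* This word occupies [[r0 - L, 0[]: it starts [L] before [a], so that [a'] and [b] together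
   determine the image under [g] from [r0] on. *)
pose a' := word_at (\val y1) (r0 - L%:Z) (size a + 4 * L).
have a'b : a' ++ b = word_at (\val y1) (r0 - L%:Z) (size a + 4 * L + size b).
  rewrite word_at_cat; congr (_ ++ _); rewrite -[LHS]yb (_ : _ + _ = 0); last first.
    by rewrite /r0 /q0; lia.
  by apply: eq_word_at => i ilh; rewrite y1y //; rewrite /q0 /p; lia.
exists a'.
  apply/(admissibleP subY (r0 - L%:Z)); exists (\val y1); first exact: set_valP.
  by rewrite a'b size_word_at.
apply/(omega1P subY (r0 - L%:Z)) => y2' Yy2.
rewrite a'b size_word_at => y2y1; rewrite (_ : _ + _ = p); last first.
  by rewrite /r0 /q0 /p; lia.
have {}y2y1 := word_at_inj y2y1.
pose y2 : Y := SigSub (mem_set Yy2).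
have x2x1 : iagree r0 (q0 + nb%:Z) (\val (g y2)) x1'.
  have -> : x1' = \val (g y1) by rewrite fK.
  by apply: gL => i ilh; apply: y2y1; move: ilh; rewrite /r0 /q0 /nb /=; lia.
have [|x3' [Xx3 x3x2 x3c]] := forcedP subX (i := r0) fc (set_valP (g y2)).
  have := proj2 (word_at_catP x1' r0 a b').
  rewrite size_cat !size_word_at => <-; last first.
    split=> //; rewrite (_ : r0 + (size a)%:Z = q0); last by rewrite /r0; lia.
    by apply: eq_word_at => i ilh; apply: x1x; lia.
  by apply: eq_word_at => i ilh; apply: x2x1; move: ilh; rewrite /r0; lia.
pose x3 : X := SigSub (mem_set Xx3).
rewrite !size_cat !size_word_at in x3x2 x3c.
have x3x : iagree q0 (q0 + (nb + nc)%:Z) x3' (\val x).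
  move=> i ilh; have [ilt|ige] := ltP i (q0 + nb%:Z).
    by rewrite x3x2 ?x2x1 ?x1x //; move: ilt ilh; rewrite /r0; lia.
  rewrite (_ : r0 + _ = q0 + nb%:Z) in x3c; last by rewrite /r0; lia.
  by apply: (word_at_inj x3c); lia.
exists (\val (f x3)); split; first exact: set_valP.
  (* Left of [p - 2L] the code [f] sees only coordinates where [x3] equals [g y2]. On [[p - 2L, p[]
     it sees only coordinates where [x3] equals [x], and there [y0], [y1] and [y2] coincide. *)
  move=> i ip; have [ilt|ige] := ltP i (p - (2 * L)%:Z).
    have -> : y2' = \val (f (g y2)) by rewrite gK.
    pose hi := p - (2 * L)%:Z.
    apply: (fL x3 (g y2) (hi - `|hi - i|) hi); last by rewrite /hi; lia.
    by move=> j jlh; apply: x3x2; move: jlh; rewrite /hi /r0 /q0 /nb /p; lia.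
  transitivity (y0 i).
    have -> : y0 = \val (f x) by rewrite gK.
    apply: (fL x3 x (p - (2 * L)%:Z) p); last by lia.
    by move=> j jlh; apply: x3x; move: jlh; rewrite /q0 /nb /nc /p; lia.
  rewrite -y1y; last by move: ip ige; rewrite /q0 /p; lia.
  by rewrite y2y1 //; move: ip ige; rewrite /r0 /q0 /p; lia.
rewrite -ys.
have -> : y0 = \val (f x) by rewrite gK.
apply: (fL x3 x p (p + 1)); last by lia.
by move=> j jlh; apply: x3x; move: jlh; rewrite /q0 /nb /nc /p; lia.
Qed.

(** * Pasts all of whose symbols are forced *)

Section ForcedPasts.
Variables (S : finType) (X : set (fullshift S)).
Hypothesis subX : subshift X.
Implicit Types (y : nat -> S) (u v w : seq S) (s : S).

Lemma left_rays_admissible y n : left_rays X y -> admissible X (ray_word y n).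
Proof.
move=> /(left_raysP subX 0)[x Xx ->]; rewrite ray_word_ray.
by apply/(admissibleP subX (0 + 1 - n%:Z)); exists x; rewrite ?size_word_at.
Qed.

(** Compactness: each suffix is read at the end of the past of some point, and a cluster point of
    these points has the whole ray as its past. *)
Lemma admissible_left_rays y :
  (forall n, admissible X (ray_word y n)) -> left_rays X y.
Proof.
move=> admy.
have xP n : exists x, X x /\ forall j, (j < n)%N -> x (- j%:Z) = y j.
  have [x Xx] := proj1 (admissibleP subX (0 + 1 - n%:Z) _) (admy n).
  rewrite size_ray_word -ray_word_ray => /(can_inj revK) e.
  exists x; split=> // j jn.
  have := congr1 (fun w => nth (y j) w j) e.
  by rewrite !nth_mkseq // /ray sub0r.
have [x xxP] := choice xP.
have [x0 Xx0 xx0] := cluster_seq (proj1 subX) (fun n => proj1 (xxP n)).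
exists x0 => // j.
have [n jn <-] := xx0 [:: - j%:Z] j.+1; last exact: mem_head.
by have [_ ->] := xxP n.
Qed.

Definition follows y s : Prop := exists k, omega1 X (ray_word y k) s.

Definition forced_past : set (nat -> S) :=
  [set y | left_rays X y /\ forall j, follows (fun i => y (i + j.+1)%N) (y j)].

Lemma follows_left_rays y s : left_rays X y -> follows y s -> left_rays X (snoc y s).
Proof.
move=> Xy [k]; rewrite -{2}(ray_cat_ray_word y k) -ray_cat_rcons; apply.
split; last by rewrite ray_cat_ray_word.
apply: admissible_left_rays => n.
have := left_rays_admissible (k + n) Xy.
rewrite ray_wordD; exact: admissible_catl.
Qed.

Lemma snoc_forced_past y s : forced_past y -> follows y s -> forced_past (snoc y s).
Proof.
move=> [Xy Ay] ys; split=> [|[|j]] /=; first exact: follows_left_rays.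
  by under eq_fun do rewrite addn1.
by have := Ay j; under [in X in _ -> X]eq_fun do rewrite addnS.
Qed.

Lemma forced_past_tail y : forced_past y ->
  forced_past (fun j => y j.+1) /\ follows (fun j => y j.+1) (y 0%N).
Proof.
move=> [Xy Ay]; split; last by have := Ay 0%N; under eq_fun do rewrite addn1.
split=> [|j]; last by have := Ay j.+1; under eq_fun do rewrite addnS.
apply: admissible_left_rays => n; have := left_rays_admissible n.+1 Xy.
by rewrite ray_wordS -cats1; exact: admissible_catl.
Qed.

Lemma forced_omega1 v u1 s u2 : forced X v (u1 ++ s :: u2) -> omega1 X (v ++ u1) s.
Proof.
elim: u1 v => [|t u1 IH] v /=; first by rewrite cats0 => -[].
by move=> [_ /IH]; rewrite cat_rcons.
Qed.

(** A letter read off a point in front of [a] makes [v] nonempty, which is what makes the words in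
    [forced_past_ends] grow without bound. *)
Lemma forced_extension u : property_D X -> admissible X u ->
  exists v, [/\ (0 < size v)%N, admissible X (v ++ u) & forced X v u].
Proof.
move=> DX Xu; have [a []] := property_D_forced subX DX (b := [::]) Xu.
rewrite cats0 /= => /(admissibleP subX 0)[x Xx xau] fa.
exists (x (- 1%:Z) :: a); split=> //; last by rewrite -cat1s; apply: forced_cat.
apply/(admissibleP subX (- 1%:Z)); exists x => //.
rewrite /word_at /mkseq /= addr0; congr cons; rewrite -[RHS]xau.
rewrite /word_at /mkseq (iotaDl 1 0) -map_comp; apply: eq_map => j /=.
by congr x; lia.
Qed.

(* The past is the limit of words u_n where u_(n+1) = v_n u_n and v_n forces u_n. *)
Lemma forced_past_ends u : property_D X -> admissible X u ->
  exists2 y, forced_past y & ray_word y (size u) = u.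
Proof.
move=> DX Xu.
(* The choice is made total by an arbitrary value on inadmissible words. *)
have /choice[e eP] w : exists v, admissible X w ->
    [/\ (0 < size v)%N, admissible X (v ++ w) & forced X v w].
  have [/forced_extension[] // v|nXw] := pselect (admissible X w).
    by exists v.
  by exists [::].
have [x0 _ _] := Xu; pose s0 := x0 0.
pose U n := iter n (fun w => e w ++ w) u.
have US n : U n.+1 = e (U n) ++ U n by [].
have XU n : admissible X (U n) by elim: n => //= n /eP[].
have sU n : (n <= size (U n))%N.
  elim: n => [//|n IH] /=; have [e0 _ _] := eP _ (XU n).
  by rewrite size_cat -addn1 addnC leq_add.
have nthU j n m : (n <= m)%N -> (j < size (U n))%N ->
    nth s0 (rev (U m)) j = nth s0 (rev (U n)) j.
  move=> /subnK <-; elim: (m - n)%N => [//|k IH] jn.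
  rewrite addSn /= rev_cat nth_cat size_rev IH // ifT //.
  elim: (k) => [//|k' IHk]; rewrite addSn /= size_cat.
  exact: leq_trans IHk (leq_addl _ _).
(* By [sU] the word [U j.+1] has more than [j] symbols, so the default [s0] is never read. *)
pose y j := nth s0 (rev (U j.+1)) j.
have yU n : ray_word y (size (U n)) = U n.
  apply: (can_inj revK); rewrite revK -[RHS](mkseq_nth s0) size_rev.
  apply/eq_in_map => j; rewrite mem_iota => /andP[_ jn].
  rewrite /y; have [jn'|/ltnW jn'] := leqP j.+1 n; first by rewrite (nthU _ _ _ jn').
  by rewrite -(nthU _ _ _ jn').
have admy n : admissible X (ray_word y n).
  have := XU n; rewrite -yU -(subnKC (sU n)) ray_wordD; exact: admissible_catr.
exists y; last exact: (yU 0%N).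
split=> [|j]; first exact: admissible_left_rays.
have jw := sU j.+1; have [_ _] := eP _ (XU j.+1).
have := yU j.+2; rewrite (US j.+1).
move: (U j.+1) (e _) (yU j.+1) jw => w v yw jw yvw.
have wE : w = ray_word (fun i => y (i + j.+1)%N) (size w - j.+1) ++ ray_word y j.+1.
  by rewrite -ray_wordD subnKC.
move=> fvw; set z := (fun _ => _) in wE *; set n := (size w - j.+1)%N in wE *.
have {}yvw : ray_word z (size v + n) ++ ray_word y j.+1 =
    (v ++ ray_word z n) ++ ray_word y j.+1.
  by rewrite -ray_wordD -catA -wE -yvw size_cat; congr ray_word; rewrite /n; lia.
have {}yvw : ray_word z (size v + n) = v ++ ray_word z n.
  move/eqP: yvw; rewrite eqseq_cat; first by case/andP=> /eqP.
  by rewrite size_cat !size_ray_word.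
(* This suffix of the past of [y j] is [v] followed by the letters of [w] that precede the symbol;
   [v] forces [w], hence this suffix forces [y j]. *)
exists (size v + n)%N; rewrite yvw.
apply: (@forced_omega1 _ _ _ (ray_word y j)).
by rewrite -rev_rcons -mkseqS -wE.
Qed.

End ForcedPasts.

(** * Measures with prescribed cylinder masses, built from Lebesgue measure *)

Section IntervalCoding.
Variables (R : realType) (S : finType).

Definition cumul (p : S -> R) k := \sum_(t | (enum_rank t < k)%N) p t.

Lemma cumul0 p : cumul p 0 = 0.
Proof. by rewrite /cumul big_pred0. Qed.

Lemma cumulS p s : cumul p (enum_rank s).+1 = cumul p (enum_rank s) + p s.
Proof.
rewrite /cumul (bigD1 s) //= addrC; congr (_ + _); apply: eq_bigl => t.
rewrite ltnS ltn_neqAle andbC; congr (_ && _).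
by rewrite (inj_eq val_inj) (inj_eq enum_rank_inj).
Qed.

Lemma cumul_card p : cumul p #|S| = \sum_t p t.
Proof. by apply: eq_bigl => t; rewrite ltn_ord. Qed.

Lemma cumul_mono p k l : (forall s, 0 <= p s) -> (k <= l)%N ->
  cumul p k <= cumul p l.
Proof.
move=> p0 kl; rewrite /cumul [leRHS](bigID (fun t => (enum_rank t < k)%N)) /=.
rewrite [X in X + _](eq_bigl (fun t => (enum_rank t < k)%N)) => [|t].
  by rewrite lerDl sumr_ge0.
by apply: andb_idl => tk; exact: leq_trans tk kl.
Qed.

(** The symbol is the one completing the least partial sum that exceeds [u]. *)
Lemma cumul_partition p u : 0 <= u < \sum_t p t ->
  exists s, cumul p (enum_rank s) <= u < cumul p (enum_rank s) + p s.
Proof.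
move=> /andP[u0 u1].
have ex : exists k, u < cumul p k by exists #|S|; rewrite cumul_card.
case: (ex_minnP ex) => -[|k] uk kmin; first by rewrite cumul0 ltNge u0 in uk.
have [kS|Sk] := ltnP k #|S|; last first.
  by have := kmin #|S|; rewrite cumul_card => /(_ u1); rewrite ltnNge Sk.
exists (enum_val (Ordinal kS)); rewrite -cumulS enum_valK /= uk andbT leNgt.
by apply/negP => /kmin; rewrite ltnn.
Qed.

End IntervalCoding.

Section CylinderMeasure.
Variables (R : realType) (S : pfinType) (m : seq S -> R).
Hypothesis m_ge0 : forall w, 0 <= m w.
Hypothesis m_nil : m [::] = 1.
Hypothesis m_rcons : forall w, m w = \sum_s m (rcons w s).
Implicit Types (u : R) (w : seq S) (s : S).

(* [0, 1[ is cut into intervals of length m w, each subdivided according to the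
   next letter; the itinerary of a uniform point then has cylinder masses m. *)
Fixpoint code_left_from (p w : seq S) : R :=
  if w is s :: w' then
    cumul (fun t => m (rcons p t)) (enum_rank s) + code_left_from (rcons p s) w'
  else 0.

Definition code_left := code_left_from [::].

Lemma code_left_rcons w s : code_left (rcons w s) =
  code_left w + cumul (fun t => m (rcons w t)) (enum_rank s).
Proof.
rewrite /code_left; suff H p : code_left_from p (rcons w s) =
    code_left_from p w + cumul (fun t => m (rcons (p ++ w) t)) (enum_rank s).
  exact: (H [::]).
elim: w p => [|t w IH] p /=; first by rewrite cats0 addr0 add0r.
by rewrite IH addrA cat_rcons.
Qed.

Definition code_itv w := `[code_left w, code_left w + m w[.

Lemma code_itv_rcons w s u : u \in code_itv (rcons w s) -> u \in code_itv w.
Proof.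
rewrite !in_itv /= code_left_rcons => /andP[ul ur]; apply/andP; split.
  by apply: le_trans ul; rewrite lerDl sumr_ge0.
apply: lt_le_trans ur _; rewrite -addrA -cumulS lerD2l m_rcons -cumul_card.
by exact: cumul_mono.
Qed.

Lemma code_itv_disj w s t u :
  u \in code_itv (rcons w s) -> u \in code_itv (rcons w t) -> s = t.
Proof.
wlog st : s t / (enum_rank s <= enum_rank t)%N => [WL|].
  by have [|/ltnW] := leqP (enum_rank s) (enum_rank t) => st us ut;
    [apply: WL|apply/esym/WL].
move: st; rewrite leq_eqVlt => /orP[/eqP/val_inj/enum_rank_inj //|st].
rewrite !in_itv /= !code_left_rcons -!addrA -!cumulS => /andP[_ us] /andP[ut _].
have le : cumul (fun t => m (rcons w t)) (enum_rank s).+1 <=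
    cumul (fun t => m (rcons w t)) (enum_rank t) by exact: cumul_mono.
by have := lt_le_trans us (le_trans (lerD (lexx _) le) ut); rewrite ltxx.
Qed.

Lemma code_itv_cover w u : u \in code_itv w ->
  exists s, u \in code_itv (rcons w s).
Proof.
rewrite in_itv /= => /andP[ul ur].
have [|s /andP[sl sr]] :=
  @cumul_partition R S (fun t => m (rcons w t)) (u - code_left w).
  by rewrite subr_ge0 ul ltrBlDl -m_rcons.
by exists s; rewrite in_itv /= code_left_rcons; lra.
Qed.

(** Along the itinerary of a point of [[0, 1[] a symbol is always found; the default serves points
    outside, where [coding] is constant. *)
Definition next_symbol u w : S :=
  odflt point [pick s | u \in code_itv (rcons w s)].

Definition coding_prefix u n : seq S :=
  iter n (fun w => rcons w (next_symbol u w)) [::].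

Definition coding (u : measurableTypeR R) : borel_onesided S :=
  fun n => next_symbol u (coding_prefix u n).

Lemma coding_prefixE u n : mkseq (coding u) n = coding_prefix u n.
Proof. by elim: n => [//|n IH]; rewrite mkseqS IH. Qed.

Lemma code_itv_nil : [set` code_itv [::]] = `[0, 1[%classic :> set R.
Proof. by rewrite /code_itv /code_left /= m_nil add0r. Qed.

Lemma coding_prefix_itv u w : u \in code_itv [::] ->
  (coding_prefix u (size w) = w) <-> u \in code_itv w.
Proof.
move=> u01; have cu n : u \in code_itv (coding_prefix u n).
  elim: n => [//|n /code_itv_cover[s us]] /=; rewrite /next_symbol.
  by case: pickP => [//|/(_ s)]; rewrite us.
split=> [<-|]; first exact: cu.
elim/last_ind: w => [//|w s IH] us; rewrite size_rcons /=.
have {IH}wE := IH (code_itv_rcons us).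
by have := cu (size w).+1; rewrite /= wE => /code_itv_disj/(_ us) ->.
Qed.

Lemma coding_out u : u \notin code_itv [::] -> coding u = (fun=> point).
Proof.
move=> u01; have nu w : u \in code_itv w = false.
  apply/negP; elim/last_ind: w => [|w s IH]; first exact/negP.
  by move=> /code_itv_rcons.
apply: funext => n; rewrite /coding /next_symbol; case: pickP => // s.
by rewrite nu.
Qed.

Lemma coding_cylinderI w :
  coding @^-1` (cylinder w) `&` [set` code_itv [::]] = [set` code_itv w].
Proof.
rewrite eqEsubset; split=> u /=; rewrite /cylinder /= coding_prefixE.
  by move=> [/coding_prefix_itv uw /uw].
move=> uw; have u01 : u \in code_itv [::].
  by move: uw; elim/last_ind: w => // w s IH /code_itv_rcons.
by split=> //; apply/coding_prefix_itv.
Qed.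

(** Inside [[0, 1[] the preimage is an interval; outside, [coding] is constant and the preimage is
    everything or nothing. *)
Lemma coding_cylinder_measurable w :
  measurable (coding @^-1` (cylinder w) : set (measurableTypeR R)).
Proof.
rewrite -[X in measurable X]setIT -(setUv [set` code_itv [::]]) setIUr.
apply: measurableU; first by rewrite coding_cylinderI; exact: measurable_itv.
have [wp|wp] := pselect (cylinder w (fun=> point)).
  rewrite (_ : _ `&` _ = ~` [set` code_itv [::]]).
    by apply: measurableC; exact: measurable_itv.
  rewrite setIC; apply/setIidPl => u /= /negP/coding_out.
  by rewrite /preimage /= => ->.
rewrite (_ : _ `&` _ = set0) // -subset0 => u [/= + /negP/coding_out uE].
by rewrite uE => /wp.
Qed.

Lemma open_cylinders (U : set (onesided S)) : open U ->
  U = \bigcup_n \bigcup_(w in [set w : n.-tuple S | cylinder w `<=` U]) cylinder w.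
Proof.
move=> oU; rewrite eqEsubset; split=> [x Ux|x [n _ [w wU]]]; last exact: wU.
have /nbhs_agreeP[F FU] : nbhs x U by apply: open_nbhs_nbhs.
pose n := (\max_(i <- F) i).+1; exists n => //.
have sz : size (mkseq x n) == n by rewrite size_mkseq.
exists (Tuple sz); last by rewrite /cylinder size_tuple.
move=> y; rewrite /cylinder size_tuple /= => yx; apply: FU => i iF.
have := congr1 (fun w => nth (x i) w i) yx.
by rewrite !nth_mkseq // ltnS leq_bigmax_seq.
Qed.

Lemma measurable_coding : measurable_fun setT coding.
Proof.
refine (@measurability _ _ _ (borel_onesided S) setT coding
  (@open (onesided S)) erefl _) => _ [U oU <-].
rewrite setTI (open_cylinders oU) preimage_bigcup.
apply: bigcupT_measurable => n; rewrite preimage_bigcup.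
apply: fin_bigcup_measurable => [|w _]; first exact: finite_finset.
exact: coding_cylinder_measurable.
Qed.

Definition lebesgue01 :=
  mrestr (@lebesgue_measure R) (measurable_itv (code_itv [::])).

HB.instance Definition _ := Measure.on lebesgue01.

Lemma lebesgue01T : lebesgue01 setT = 1%E.
Proof.
rewrite /lebesgue01 /mrestr setTI code_itv_nil lebesgue_measure_itv /=.
by rewrite lte_fin ltr01 oppr0 adde0.
Qed.

HB.instance Definition _ :=
  Measure_isProbability.Build _ _ _ lebesgue01 lebesgue01T.

(** A Kolmogorov extension: the distribution of [coding] under Lebesgue measure on [[0, 1[] gives
    each cylinder the length of its interval. *)
Lemma exists_cylinder_measure :
  exists mu : probability (borel_onesided S) R, forall w, mass mu w = m w.
Proof.
exists (distribution lebesgue01 (mfun_Sub (mem_set measurable_coding))) => w.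
suff E : lebesgue01 (coding @^-1` (cylinder w)) = (m w)%:E.
  by rewrite /mass [X in fine X]E.
rewrite /lebesgue01 /mrestr coding_cylinderI.
rewrite lebesgue_measure_itv /= lte_fin ltrDl; case: ltgtP (m_ge0 w) => // mw _.
  by rewrite -EFinD addrAC subrr add0r.
by rewrite -mw.
Qed.

End CylinderMeasure.

(** * Markov measures with unbounded memory and the graph they span *)

Section BigTuples.
Variables (R : nmodType) (S : finType) (N : nat).

Lemma sum_tuple_cons (P : pred S) (F : N.+1.-tuple S -> R) :
  \sum_(a | P (thead a)) F a =
  \sum_(s | P s) \sum_(b : N.-tuple S) F [tuple of s :: b].
Proof.
rewrite pair_big_dep /=.
rewrite (reindex (fun sb : S * N.-tuple S => [tuple of sb.1 :: sb.2])) /=.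
  by apply: eq_bigl => -[s b]; rewrite andbT theadE.
exists (fun a => (thead a, [tuple of behead a])) => [[s b] _|a _] /=.
  by rewrite theadE; congr pair; exact: val_inj.
by rewrite -tuple_eta.
Qed.

End BigTuples.

Section ForcedGraph.
Variables (R : realType) (S : pfinType) (X : set (fullshift S)).
Hypothesis subX : subshift X.
Hypothesis follow_ex : forall y, left_rays X y -> exists s, follows X y s.
Implicit Types (y z : nat -> S) (s : S) (w : seq S) (n k : nat).

Definition forcing_time y s : pred nat := fun k => `[< omega1 X (ray_word y k) s >].

(* 1 / (k + 1) for the length k of the shortest suffix of y forcing s, and 0 if
   no suffix does. *)
Definition weight y s : R :=
  if pselect (exists k, forcing_time y s k) is left e
  then (ex_minn e).+1%:R^-1 else 0.

Lemma weight_ge0 y s : 0 <= weight y s.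
Proof. by rewrite /weight; case: pselect => // e; rewrite invr_ge0. Qed.

Lemma weight_ge y s k : omega1 X (ray_word y k) s -> k.+1%:R^-1 <= weight y s.
Proof.
move=> oyk; have yk : forcing_time y s k by apply/asboolP.
rewrite /weight; case: pselect => [e|[]]; last by exists k.
case: ex_minnP => l _ /(_ _ yk) lk.
by rewrite lef_pV2 ?posrE // ler_nat.
Qed.

Lemma weight_gt0 y s : 0 < weight y s <-> follows X y s.
Proof.
split=> [|[k /weight_ge]]; last by apply: lt_le_trans; rewrite invr_gt0.
rewrite /weight; case: pselect => [e _|]; last by rewrite ltxx.
by case: (e) => k /asboolP; exists k.
Qed.

(** If the shortest suffix of [y] forcing [s] has length at most [n], it is also a suffix of [z];
    otherwise the weight for [y] is itself below the error term. *)
Lemma weight_agree_le y z s n : (forall j, (j < n)%N -> y j = z j) ->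
  weight y s <= weight z s + n.+1%:R^-1.
Proof.
move=> yz; rewrite {1}/weight; case: pselect => [e|_]; last first.
  by rewrite addr_ge0 ?weight_ge0 // invr_ge0.
case: ex_minnP => k /asboolP yk _; have [kn|nk] := leqP k n.
  rewrite (le_trans (_ : _ <= weight z s)) ?lerDl ?invr_ge0 //.
  apply: weight_ge; rewrite -(@eq_ray_word _ y) // => j jk.
  by apply: yz; exact: leq_trans jk kn.
apply: le_trans (_ : n.+1%:R^-1 <= _); last by rewrite lerDr weight_ge0.
by rewrite lef_pV2 ?posrE // ler_nat ltnW.
Qed.

Lemma weight_agree y z s n : (forall j, (j < n)%N -> y j = z j) ->
  `|weight y s - weight z s| <= n.+1%:R^-1.
Proof.
move=> yz; have := weight_agree_le s yz.
have := @weight_agree_le z y s n (fun j jn => esym (yz j jn)).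
by move=> zy yz1; rewrite ler_distl lerBlDr zy yz1.
Qed.

Definition total_weight y : R := \sum_s weight y s.

Lemma weight_le_total y s : weight y s <= total_weight y.
Proof.
rewrite /total_weight (bigD1 s) //= lerDl; apply: sumr_ge0 => t _.
exact: weight_ge0.
Qed.

Lemma total_weight_gt0 y : left_rays X y -> 0 < total_weight y.
Proof.
by move=> /follow_ex[s /weight_gt0/lt_le_trans]; apply; exact: weight_le_total.
Qed.

Lemma total_weight_agree y z n : (forall j, (j < n)%N -> y j = z j) ->
  `|total_weight y - total_weight z| <= #|S|%:R * n.+1%:R^-1.
Proof.
move=> yz; rewrite /total_weight -sumrB mulr_natl -sumr_const.
apply: le_trans (ler_norm_sum _ _ _) _; apply: ler_sum => s _.
exact: weight_agree.
Qed.

Definition transition y s : R := weight y s / total_weight y.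

Lemma total_weight_ge0 y : 0 <= total_weight y.
Proof. by apply: sumr_ge0 => s _; exact: weight_ge0. Qed.

Lemma transition_ge0 y s : 0 <= transition y s.
Proof. by rewrite divr_ge0 ?weight_ge0 ?total_weight_ge0. Qed.

Lemma transition_sum y : left_rays X y -> \sum_s transition y s = 1.
Proof. by move=> Xy; rewrite -mulr_suml divff ?gt_eqF ?total_weight_gt0. Qed.

Lemma transition_gt0 y s : left_rays X y -> 0 < transition y s <-> follows X y s.
Proof. by move=> Xy; rewrite -weight_gt0 pmulr_lgt0 ?invr_gt0 ?total_weight_gt0. Qed.

Lemma transition_le1 y s : left_rays X y -> transition y s <= 1.
Proof.
move=> Xy.
by rewrite ler_pdivrMr ?total_weight_gt0 // mul1r weight_le_total.
Qed.

Lemma transition_agree y z (c : R) s n : left_rays X y -> left_rays X z ->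
  (forall j, (j < n)%N -> y j = z j) -> 0 < c -> c <= total_weight y ->
  `|transition y s - transition z s| <= #|S|.+1%:R / c * n.+1%:R^-1.
Proof.
move=> Xy Xz yz c0 cy.
have y0 := total_weight_gt0 Xy; have z0 := total_weight_gt0 Xz.
(* In this form the outer denominator is [total_weight y], bounded below by [c], and
   [transition z s] is at most 1. The constant [#|S|.+1] counts one weight difference for [s] and
   [#|S|] for the totals. *)
have -> : transition y s - transition z s =
    (weight y s - weight z s) / total_weight y -
    transition z s * (total_weight y - total_weight z) / total_weight y.
  by rewrite /transition; field; rewrite !gt_eqF.
have iy : 0 <= (total_weight y)^-1 by rewrite invr_ge0 ltW.
rewrite -mulrBl normrM (ger0_norm iy) [leRHS]mulrAC.
apply: ler_pM => //; last by rewrite lef_pV2.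
apply: le_trans (ler_normB _ _) _.
rewrite -natr1 mulrDl mul1r addrC lerD //; last exact: weight_agree.
rewrite normrM -[leRHS]mul1r ler_pM ?total_weight_agree //.
by rewrite ger0_norm ?transition_ge0 ?transition_le1.
Qed.

(** Cylinder masses of the chain whose state is the entire left ray, started at [y]. *)
Fixpoint path_mass y w : R :=
  if w is s :: w' then transition y s * path_mass (snoc y s) w' else 1.

Lemma path_mass_ge0 y w : 0 <= path_mass y w.
Proof. by elim: w y => //= s w IH y; rewrite mulr_ge0 ?transition_ge0. Qed.

Lemma path_mass_rcons y w s :
  path_mass y (rcons w s) = path_mass y w * transition (ray_cat y w) s.
Proof.
elim: w y => [|t w IH] y /=; first by rewrite ray_cat0 mulr1 mul1r.
by rewrite IH mulrA ray_cat_cons.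
Qed.

(** Transitions are known to sum to 1 only at left rays of [X]; branches that leave them carry the
    factor 0. *)
Lemma transition0_or_left_rays y s : left_rays X y ->
  transition y s = 0 \/ left_rays X (snoc y s).
Proof.
move=> Xy; have := transition_ge0 y s.
rewrite le_eqVlt => /orP[/eqP|]; first by left.
by move=> /(transition_gt0 _ Xy); right; exact: follows_left_rays.
Qed.

Lemma path_mass_sum y w : left_rays X y ->
  path_mass y w = \sum_s path_mass y (rcons w s).
Proof.
elim: w y => [|t w IH] y Xy /=.
  by under eq_bigr do rewrite mulr1; rewrite transition_sum.
rewrite -mulr_sumr; have [->|Xyt] := transition0_or_left_rays t Xy.
  by rewrite !mul0r.
by rewrite -IH.
Qed.

Lemma path_mass_tuple_sum y n : left_rays X y ->
  \sum_(a : n.-tuple S) path_mass y a = 1.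
Proof.
elim: n y => [|n IH] y Xy.
  rewrite (big_pred1 [tuple]) // => a; apply/esym/eqP; exact: tuple0.
rewrite (sum_tuple_cons predT) /= -(transition_sum Xy); apply: eq_bigr => s _.
rewrite -mulr_sumr; have [->|Xys] := transition0_or_left_rays s Xy.
  by rewrite !mul0r.
by rewrite IH // mulr1.
Qed.

Lemma forced_past_cat y w : forced_past X y ->
  0 < path_mass y w <-> forced_past X (ray_cat y w).
Proof.
move=> Ay; split.
  elim/last_ind: w => [|w s IH]; first by rewrite ray_cat0.
  rewrite path_mass_rcons ray_cat_rcons => ws.
  have w0 : 0 < path_mass y w.
    rewrite lt_neqAle path_mass_ge0 andbT eq_sym; apply/eqP => w0.
    by rewrite w0 mul0r ltxx in ws.
  have Ayw := IH w0; apply: snoc_forced_past => //.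
  by apply/transition_gt0; [case: Ayw|rewrite pmulr_rgt0 in ws].
elim/last_ind: w => [|w s IH] //=.
rewrite path_mass_rcons ray_cat_rcons => /(forced_past_tail subX)[/= Ayw ws].
by rewrite mulr_gt0 ?IH //; apply/transition_gt0 => //; case: Ayw.
Qed.

Lemma forced_past_catl y w : forced_past X (ray_cat y w) -> forced_past X y.
Proof.
elim/last_ind: w => [|w s IH]; first by rewrite ray_cat0.
by rewrite ray_cat_rcons => /(forced_past_tail subX)[/IH].
Qed.

(** Membership depends on cylinder masses only, so it does not separate measures that agree as Borel
    measures. *)
Definition forced_measures : set (probability (borel_onesided S) R) :=
  [set mu | exists2 y, forced_past X y & forall w, mass mu w = path_mass y w].

Lemma exists_forced_measure y : forced_past X y ->
  exists2 mu, forced_measures mu & forall w, mass mu w = path_mass y w.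
Proof.
move=> Ay; have [Xy _] := Ay.
have [||w|mu muE] := @exists_cylinder_measure R S (path_mass y).
- exact: path_mass_ge0.
- by [].
- exact: path_mass_sum.
- by exists mu => //; exists y.
Qed.

(** Dividing by the first transition probability leaves the path masses from the past with [s]
    appended, again a forced past. *)
Lemma forced_transition_complete : transition_complete forced_measures.
Proof.
move=> mu s [y Ay muE]; rewrite muE /= mulr1 => ys.
have [Xy _] := Ay.
have [|nu Mnu nuE] := @exists_forced_measure (snoc y s).
  by apply: snoc_forced_past => //; exact/(transition_gt0 _ Xy).
by exists nu => // b; rewrite nuE !muE /= mulr1 mulrC mulKf // gt_eqF.
Qed.

(** The last symbol of a forced past follows its tail, so the measure of the tail gives that symbol
    positive mass and is sent to [mu]. *)
Lemma forced_in_complete : in_complete forced_measures.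
Proof.
move=> mu [y /(forced_past_tail subX)[]].
rewrite (_ : y = snoc (fun j => y j.+1) (y 0%N)) /=; last by apply: funext => -[].
move: (fun j => y j.+1) (y 0%N) => {}y s Ay ys muE.
have [Xy _] := Ay; have y0 := proj2 (transition_gt0 s Xy) ys.
have [nu Mnu nuE] := exists_forced_measure Ay.
exists nu, s; split=> // [|b]; rewrite !nuE /= ?mulr1 //.
by rewrite muE mulrC mulKf // gt_eqF.
Qed.

Definition marg n y : {ffun n.-tuple S -> R} :=
  [ffun a : n.-tuple S => path_mass y a].

Lemma level_marg n y : forced_past X y -> level forced_measures (marg n y).
Proof.
case: n => [|n] Ay /=.
  by apply/ffunP => a; rewrite !ffunE tuple0.
have [mu Mmu muE] := exists_forced_measure Ay; exists mu => //.
by apply/ffunP => a; rewrite !ffunE muE.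
Qed.

Lemma levelP n (p : {ffun n.-tuple S -> R}) : (0 < n)%N ->
  level forced_measures p -> exists2 y, forced_past X y & p = marg n y.
Proof.
case: n p => // n p _ [mu [y Ay muE] <-]; exists y => //.
by apply/ffunP => a; rewrite !ffunE muE.
Qed.

Lemma first_mass_marg n y s : left_rays X y ->
  first_mass (marg n.+1 y) s = transition y s.
Proof.
move=> Xy; rewrite /first_mass (sum_tuple_cons (pred1 s)) big_pred1_eq.
under eq_bigr do rewrite ffunE /=.
rewrite -mulr_sumr; have [->|Xys] := transition0_or_left_rays s Xy.
  by rewrite mul0r.
by rewrite path_mass_tuple_sum // mulr1.
Qed.

Lemma ftau_marg n y s : left_rays X y -> ftau s (marg n.+1 y) =
  if 0 < transition y s then Some (marg n (snoc y s)) else None.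
Proof.
move=> Xy; rewrite /ftau first_mass_marg //; case: ifP => // ys; congr Some.
by apply/ffunP => b; rewrite !ffunE /= mulrC mulKf // gt_eqF.
Qed.

Lemma ftau_word_marg n y w : left_rays X y -> ftau_word (marg (size w + n) y) =
  if 0 < path_mass y w then Some (marg n (ray_cat y w)) else None.
Proof.
elim: w y => [|s w IH] y Xy /=; first by rewrite ltr01 ray_cat0.
rewrite (ftau_marg _ _ Xy); case: ifPn => [ys|]; last first.
  rewrite -leNgt => ys; have -> : transition y s = 0.
    by apply/le_anti; rewrite ys transition_ge0.
  by rewrite mul0r ltxx.
rewrite /= IH; first by rewrite pmulr_rgt0 // ray_cat_cons.
by apply: follows_left_rays => //; exact/(transition_gt0 _ Xy).
Qed.

Definition marg_vertex n y : vertex R S := existT _ n (marg n y).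

Lemma edge_marg n y s (v : vertex R S) : forced_past X y ->
  edge forced_measures (marg_vertex n y) s v ->
  exists n', v = marg_vertex n' (snoc y s) /\ forced_past X (snoc y s).
Proof.
move=> Ay; move e : (marg_vertex n y) => u uv; case: uv e => n' t p q _ _.
move=> pq e; have nn' : n = n'.+1 by case: e.
subst n; have {e}pE : marg n'.+1 y = p.
  (* Vertices are dependent pairs over [nat], whose decidable equality lets the second components be
     compared. *)
  by apply: (Eqdep_dec.inj_pair2_eq_dec _ PeanoNat.Nat.eq_dec) e.
exists n'; have [Xy _] := Ay; move: pq; rewrite -pE ftau_marg //.
case: ifP => // yt [<-]; split=> //; apply: snoc_forced_past => //.
exact/(transition_gt0 _ Xy).
Qed.

Lemma labels_path_admissible n y w : forced_past X y ->
  labels_path_from forced_measures (marg_vertex n y) w ->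
  forced_past X (ray_cat y w).
Proof.
elim: w n y => [|s w IH] n y Ay /=; first by rewrite ray_cat0.
by move=> [v /(edge_marg Ay)[n' [-> Ays]] /(IH _ _ Ays)]; rewrite ray_cat_cons.
Qed.

Lemma forced_labels_path y w : forced_past X (ray_cat y w) ->
  labels_path_from forced_measures (marg_vertex (size w) y) w.
Proof.
elim: w y => [|s w IH] y Ayw; first exact: level_marg (forced_past_catl Ayw).
have Ay := forced_past_catl Ayw; rewrite ray_cat_cons in Ayw.
exists (marg_vertex (size w) (snoc y s)); last exact: IH.
have Ays := forced_past_catl Ayw; have [/= _ ys] := forced_past_tail subX Ays.
apply: Edge; [exact: level_marg|exact: level_marg|].
have [Xy _] := Ay.
by rewrite ftau_marg // ifT //; exact/(transition_gt0 _ Xy).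
Qed.

Lemma forced_presents : property_D X -> presents forced_measures X.
Proof.
move=> DX [//|s w] _; split=> [Xw|[[n p]]].
  have [y Ay yw] := forced_past_ends subX DX Xw.
  have yE := ray_cat_ray_word y (size (s :: w)); rewrite yw in yE.
  exists (marg_vertex (size (s :: w)) (fun j => y (j + size (s :: w))%N)).
  by apply: forced_labels_path; rewrite yE.
(* The path is nonempty, so an edge leaves the vertex; its level is therefore positive and [levelP]
   applies. *)
move=> sw; have [y Ay pE] : exists2 y, forced_past X y & p = marg n y.
  case: sw => v; move e : (existT _ n p) => u uv _.
  case: uv e => n' t p' q p'M _ _ e.
  have nn' : n = n'.+1 by case: e.
  subst n; have -> := Eqdep_dec.inj_pair2_eq_dec _ PeanoNat.Nat.eq_dec _ _ _ _ e.
  exact: levelP.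
rewrite {}pE in sw.
have [Xyw _] := labels_path_admissible Ay sw.
have := left_rays_admissible subX (size (s :: w)) Xyw.
by have := ray_word_cat y (s :: w) 0; rewrite addn0 ray_word0 => ->.
Qed.

Lemma dist1_le (p q : {ffun 1.-tuple S -> R}) (e : R) :
  (forall a, `|p a - q a| <= e) -> dist1 p q <= Num.sqrt #|S|%:R * e.
Proof.
move=> pq; have e0 : 0 <= e by exact: le_trans (pq [tuple point]).
rewrite -[e in leRHS]ger0_norm // -sqrtr_sqr -sqrtrM // ler_wsqrtr //.
apply: (@le_trans _ _ (\sum_(a : 1.-tuple S) e ^+ 2)).
  by apply: ler_sum => a _; rewrite -real_normK ?num_real // lerXn2r ?nnegrE.
by rewrite sumr_const card_tuple expn1 mulr_natl.
Qed.

(** Following the word from a forced past appends it to that past, so all images come from rays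
    sharing their last [n] symbols with [y]. *)
Lemma tau_images_marg y n q : left_rays X y ->
  tau_images forced_measures (ray_word y n) q ->
  exists z, [/\ left_rays X z, forall j, (j < n)%N -> y j = z j & q = marg 1 z].
Proof.
move=> Xy [p /levelP[|z Az ->]]; first by rewrite addn1.
have [Xz _] := Az; rewrite ftau_word_marg //; case: ifP => // zw [<-].
exists (ray_cat z (ray_word y n)); split=> // [|j jn].
  by have [] := proj1 (forced_past_cat _ Az) zw.
by rewrite /ray_cat /ray_word revK nth_mkseq.
Qed.

(** The supremum defining [diam] is [-oo] on the empty set, so the lower bound 0 requires an image
    for every [n]. *)
Lemma tau_images_nonempty y n : property_D X -> left_rays X y ->
  tau_images forced_measures (ray_word y n) !=set0.
Proof.
move=> DX Xy; have Xw := left_rays_admissible subX n Xy.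
have [z Az] := forced_past_ends subX DX Xw; rewrite size_ray_word => zy.
have := ray_cat_ray_word z n; rewrite zy => zE; rewrite -zE in Az.
have Az' := forced_past_catl Az; have [Xz _] := Az'.
eexists; exists (marg (size (ray_word y n) + 1) (fun j => z (j + n)%N)).
  exact: level_marg.
by rewrite ftau_word_marg // ifT //; exact/forced_past_cat.
Qed.

Lemma forced_contractive : property_D X -> contractive forced_measures X.
Proof.
move=> DX y Xy; have [s0 [k0 yk0]] := follow_ex Xy.
(* Every ray sharing its last [k0] symbols with [y] also forces [s0], so [c] is a uniform lower
   bound for the total weights. *)
pose c : R := k0.+1%:R^-1.
pose C : R := Num.sqrt #|S|%:R * (#|S|.+1%:R / c).
have c0 : 0 < c by rewrite invr_gt0.
have diam_le n : (k0 <= n)%N ->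
    (diam (tau_images forced_measures (ray_word y n)) <= (C * n.+1%:R^-1)%:E)%E.
  move=> k0n; apply: ub_ereal_sup => _ [p pn [q qn <-]]; rewrite lee_fin -mulrA.
  have [z1 [Xz1 yz1 ->]] := tau_images_marg Xy pn.
  have [z2 [Xz2 yz2 ->]] := tau_images_marg Xy qn.
  apply: dist1_le => a; rewrite !ffunE.
  case/tupleP: a => s a; rewrite tuple0 /= !mulr1.
  apply: transition_agree => //; first by move=> j jn; rewrite -yz1 // yz2.
  apply: le_trans (weight_le_total _ s0); apply: weight_ge.
  rewrite -(@eq_ray_word _ y) // => j jk; apply: yz1; exact: leq_trans jk k0n.
have diam_ge n : (0 <= diam (tau_images forced_measures (ray_word y n)))%E.
  have [q qn] := tau_images_nonempty n DX Xy.
  apply: ereal_sup_ubound; exists q => //; exists q => //.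
  by rewrite /dist1 big1 ?sqrtr0 // => a _; rewrite subrr expr0n.
apply: (@squeeze_cvge _ _ _ _ (fun=> 0%E) _ (fun n => (C * n.+1%:R^-1)%:E)).
- by exists k0 => // n /= /diam_le ->; rewrite diam_ge.
- exact: cvg_cst.
- apply: cvg_EFin; first by apply: nearW.
  rewrite -[0]/(fine 0%:E) -[X in _ --> X](mulr0 C).
  by apply: cvgMr; exact: cvg_harmonic.
Qed.

End ForcedGraph.

(** * Assembly, pointed alphabets and the empty subshift *)

Lemma property_g_follows (S : finType) (X : set (fullshift S)) :
  property_g X -> forall y, left_rays X y -> exists s, follows X y s.
Proof. by move=> gX y /gX[s [n _ yn]]; exists s, n.+1. Qed.

Lemma forced_presentation (R : realType) (S : pfinType) (X : set (fullshift S)) :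
  subshift X -> property_D X -> property_g X ->
  exists M : set (probability (borel_onesided S) R),
    [/\ transition_complete M /\ in_complete M, presents M X & contractive M X].
Proof.
move=> subX DX /property_g_follows gX; exists (@forced_measures R S X).
split; first by split; [exact: forced_transition_complete|exact: forced_in_complete].
  exact: forced_presents.
exact: forced_contractive.
Qed.

Lemma conjugate_set0 (S T : finType) :
  conjugate (set0 : set (fullshift S)) (set0 : set (fullshift T)).
Proof.
have E (U : Type) (x : (set0 : set U)) : False by have := set_valP x.
by exists (fun x => False_rect _ (E _ x)), (fun x => False_rect _ (E _ x));
  split=> [x|x|x|x|x]; case: (E _ x).
Qed.

(** Destructing [S] lets the pointed type be packed on the same carrier and finiteness class, so its
    underlying [finType] is the original one. *)
Lemma pfinType_ind (P : finType -> Prop) :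
  (forall T : pfinType, P T) -> forall S : finType, S -> P S.
Proof.
move=> PT [S cS] s0.
pose T : pfinType := HB.pack S cS (isPointed.Build S s0).
exact: (PT T).
Qed.

Theorem mainTheorem5 (R : realType) (Sigma : finType)
    (X : set (fullshift Sigma))
    (subX : subshift X) (DX : property_D X)
    (gX : exists (Sigma' : finType) (Y : set (fullshift Sigma')),
        [/\ subshift Y, conjugate X Y & property_g Y]) :
  exists (Sigma_bar : pfinType) (X_bar : set (fullshift Sigma_bar))
      (M : set (probability (borel_onesided Sigma_bar) R)),
    [/\ subshift X_bar, conjugate X X_bar,
        transition_complete M /\ in_complete M,
        presents M X_bar & contractive M X_bar].
Proof.
have [Sigma' [Y [subY XY gY]]] := gX.
have DY := conjugate_property_D subX subY XY DX.
have main (T : finType) (t : T) (Z : set (fullshift T)) :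
    subshift Z -> conjugate X Z -> property_D Z -> property_g Z ->
    exists (Sigma_bar : pfinType) (X_bar : set (fullshift Sigma_bar))
        (M : set (probability (borel_onesided Sigma_bar) R)),
      [/\ subshift X_bar, conjugate X X_bar,
          transition_complete M /\ in_complete M,
          presents M X_bar & contractive M X_bar].
  move: T t Z; apply: pfinType_ind => T Z subZ XZ DZ gZ.
  have [M [MM presM contrM]] := forced_presentation R subZ DZ gZ.
  by exists T, Z, M.
have [[x Xx]|/nonemptyPn X0] := pselect (X !=set0).
  have [f _] := XY.
  exact: (main _ (\val (f (SigSub (mem_set Xx))) 0) Y).
(* For empty [X] the alphabet of [Y] may be empty too, hence the empty subshift over a nonempty
   alphabet is taken instead. *)
apply: (main bool true set0).
- by split; [exact: closed0|rewrite image_set0].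
- by rewrite X0; exact: conjugate_set0.
- by move=> b s [x []].
- by move=> y [x []].
Qed.
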